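(* Let $(Z_n)_{n\ge0}$ be a BPIRE (as in the context) with offspring p.g.f. $\varphi_n$ and $M_n$ immigrants in generation $n$, which is an irreducible Markov chain under $Q$ (on state space $\mathbb{N}$ or $\mathbb{N}_0$). Assume: (1) $(\varphi_n,M_n)_{n\in\mathbb{N}}$ is i.i.d. under $Q$; (2) with $\mu_n:=\varphi_n'(1)$, $E_Q[|\log\mu_1|^2]<\infty$, $E_Q[\log\mu_1]=0$ and $Q[\mu_1=1]<1$; (3) $E_Q[(\log_+ M_1)^{2+\epsilon}]<\infty$ for some $\epsilon>0$. Then $(Z_n)_{n\ge0}$ is recurrent.
   Context: Branching process in random environment with immigration (BPIRE) with deterministic-given-environment immigration: the environment is a sequence $(\varphi_n,M_n)_{n\in\mathbb{N}}$ of pairs, where $\varphi_n$ is a (random) probability generating function of a distribution on $\mathbb{N}_0$ and $M_n$ is an $\mathbb{N}_0$-valued random variable, defined on a probability space with measure $Q$. Write $Q_{(\varphi,M)}:=Q[\cdot\mid(\varphi_n,M_n)_{n}]$. Conditionally on the environment, $\{\xi^{(n)}_j: j,n\in\mathbb{N}\}$ are independent, with $\xi^{(n)}_j$ having p.g.f. $\varphi_n$. Set $Z_0:=0$ and $Z_n:=\xi^{(n)}_1+\dots+\xi^{(n)}_{Z_{n-1}}+M_n$ for $n\ge1$ ($\xi^{(n)}_j$ is the number of offspring of the $j$-th individual of generation $n-1$, $M_n$ the number of immigrants in generation $n$). Under $Q$, $(Z_n)$ is a time-homogeneous Markov chain; recurrence/transience refer to this chain. $\log_+x=\max(\log x,0)$.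 *)

(* Defs.v *)
From HB Require Import structures.
From mathcomp Require Import all_boot all_order all_algebra.
From mathcomp Require Import all_classical all_reals all_analysis.
Set Implicit Arguments. Unset Strict Implicit. Unset Printing Implicit Defensive.
Import Order.TTheory GRing.Theory Num.Theory.
Import numFieldNormedType.Exports.
Local Open Scope classical_set_scope.
Local Open Scope ring_scope.

Section BPIRE.
Context {R : realType} {d : measure_display} {Omega : measurableType d}
  {de : measure_display} {E : measurableType de}.

(* The environment in generation n (n >= 1) is env n : Omega -> E; the
   offspring distribution of generation n is the pmf  f (env n w) : nat -> R
   (whose p.g.f. is phi_n) and the number of immigrants is M_n = g (env n w). *)

(* mean offspring number mu = phi'(1) = sum_k k p_k  (in [0, +oo]) *)
Definition mean_off (f : E -> nat -> R) (e : E) : \bar R :=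
  (\sum_(k <oo) ((k%:R * f e k)%:E))%E.

Definition logp (x : R) : R := Num.max (ln x) 0.

Definition env_cyl (env : nat -> Omega -> E) (m : nat) (idx : 'I_m -> nat)
  (B : 'I_m -> set E) : set Omega :=
  \bigcap_(i in [set: 'I_m]) (env (idx i) @^-1` B i).

Definition step (env : nat -> Omega -> E) (g : E -> nat)
  (xi : nat -> nat -> Omega -> nat) (n x : nat) (w : Omega) : nat :=
  (\sum_(j < x) xi n j.+1 w + g (env n w))%N.

Fixpoint Z (env : nat -> Omega -> E) (g : E -> nat)
  (xi : nat -> nat -> Omega -> nat) (n : nat) (w : Omega) : nat :=
  match n with
  | 0 => 0%N
  | n'.+1 => step env g xi n'.+1 (Z env g xi n' w) w
  end.

(* transition kernel of the (time-homogeneous, by i.i.d.-ness) Markov chain Z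
   under Q: from state x the next state has the law of
   xi^(1)_1 + ... + xi^(1)_x + M_1 *)
Definition bpire_kernel (Q : probability Omega R) (env : nat -> Omega -> E)
  (g : E -> nat) (xi : nat -> nat -> Omega -> nat) (x y : nat) : \bar R :=
  Q (step env g xi 1 x @^-1` [set y]).

(* first passage probabilities: fp K n x y = P_x(first visit to y at step n+1) *)
Fixpoint fp (K : nat -> nat -> \bar R) (n x y : nat) : \bar R :=
  match n with
  | 0 => K x y
  | n'.+1 => (\sum_(z <oo | z != y) (K x z * fp K n' z y))%E
  end.

Definition recurrent_state (K : nat -> nat -> \bar R) (x : nat) : Prop :=
  (\sum_(n <oo) fp K n x x)%E = 1%E.

Definition leads_to (K : nat -> nat -> \bar R) (x y : nat) : Prop :=
  exists s : seq nat, path (fun a b => (0 < K a b)%E) x s /\ last x s = y.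

Definition irreducible_on (K : nat -> nat -> \bar R) (S : set nat) : Prop :=
  (forall x y, S x -> ~ S y -> K x y = 0%E) /\
  (forall x y, S x -> S y -> leads_to K x y).

End BPIRE.

(* Main.v *)
(** Conditions (2) and (3) make [V z = log (log (e + z))] a Lyapunov function.
Given the environment, Jensen's inequality (concavity of [V]) replaces the
offspring sum by its mean, so it suffices to bound [E (V (mu x + M))]. With
[L = log (e + x)] and [Y = log mu], the variable [log (e + mu x + M)] is at most
[L + Y + W], where the excess [W >= 0] satisfies [E W = o (1 / L)] by dominated
convergence and the second moments of [Y] and [log_+ M]. As [E Y = 0], expanding
[log] at [L] gives
[E (V (mu x + M)) - V x <= E W / L - c / L^2 + o (1 / L^2) < 0] for large [x],
where [c > 0] because [Y] is not almost surely zero. A function tending to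
infinity which is superharmonic off a finite set forces recurrence of an
irreducible chain, by the minimum principle applied to the hitting
probabilities. *)

Require Import Defs.
From HB Require Import structures.
From mathcomp Require Import all_boot all_order all_algebra.
From mathcomp Require Import all_classical all_reals all_analysis.
From mathcomp Require Import measurable_realfun ring lra.
Set Implicit Arguments. Unset Strict Implicit.
Import Order.TTheory GRing.Theory Num.Theory.
Import numFieldNormedType.Exports.
Local Open Scope classical_set_scope.
Local Open Scope ring_scope.

(** * Foster-Lyapunov criterion for recurrence of a countable chain *)

Section Foster.
Context {R : realType} (K : nat -> nat -> \bar R).
Hypothesis K_ge0 : forall x y, (0 <= K x y)%E.
Hypothesis K_sum1 : forall x, (\sum_(z <oo) K x z = 1)%E.

Lemma fp_ge0 n x y : (0 <= fp K n x y)%E.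
Proof.
elim: n x => [|n IH] x /=; first exact: K_ge0.
by apply: nneseries_ge0 => z _ _; apply: mule_ge0.
Qed.

(** Only visits at times at least 1 count, so [hitting y y] is the return probability, and
    recurrence of [y] says that it equals 1. *)
Definition hitting (y x : nat) : \bar R := \sum_(n <oo) fp K n x y.

Lemma hitting_ge0 y x : (0 <= hitting y x)%E.
Proof. by apply: nneseries_ge0 => n _ _; exact: fp_ge0. Qed.

Lemma kernel_fin_num x z : K x z \is a fin_num.
Proof.
rewrite ge0_fin_numE ?K_ge0//; apply: (@le_lt_trans _ _ 1%E); last exact: ltry.
rewrite -(K_sum1 x) (@nneseriesD1 _ _ z)//= leeDl//.
by apply: nneseries_ge0 => *; exact: K_ge0.
Qed.

Lemma fpSE n x y :
  fp K n.+1 x y = (\sum_(z <oo) K x z * (if z == y then 0 else fp K n z y))%E.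
Proof.
rewrite /= eseries_mkcond; apply: eq_eseriesr => z _.
by case: eqVneq => _ /=; rewrite ?mule0.
Qed.

(** Induction on the horizon by first-step decomposition: the first jump either lands at [y], or
    lands at some [z] other than [y], from where the remaining passage probabilities sum to at most
    1. *)
Lemma sum_fp_le1 y N x : (\sum_(0 <= n < N) fp K n x y <= 1)%E.
Proof.
elim: N x => [|N IH] x; first by rewrite big_geq// lee01.
rewrite big_nat_recl//; under eq_bigr do rewrite fpSE.
rewrite -nneseries_sum_nat; last first.
  by move=> i z; case: ifP => _; rewrite ?mule0// mule_ge0 ?fp_ge0.
rewrite -(K_sum1 x) [leRHS](@nneseriesD1 _ _ y)// leeD2l//.
rewrite [leRHS]eseries_mkcond; apply: lee_nneseries => [z _ _|z _].
  by apply: sume_ge0 => i _; case: ifP => _; rewrite ?mule0// mule_ge0 ?fp_ge0.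
case: eqVneq => _ /=; first by rewrite big1// => i _; rewrite mule0.
rewrite -ge0_sume_distrr; last by move=> i _; exact: fp_ge0.
by rewrite -[leRHS]mule1 lee_wpmul2l.
Qed.

Lemma hitting_le1 y x : (hitting y x <= 1)%E.
Proof.
apply: lime_le.
  by apply: is_cvg_nneseries => n _ _; exact: fp_ge0.
by apply: nearW => n; exact: sum_fp_le1.
Qed.

(** First-step decomposition, with two nonnegative series interchanged. The value at [z = y] is 1,
    the target being already reached, and not the return probability. *)
Lemma hittingE y x :
  hitting y x = (\sum_(z <oo) K x z * (if z == y then 1 else hitting y z))%E.
Proof.
have fp0 n z : (0 <= if z == y then 0 else fp K n z y)%E.
  by case: ifP => // _; exact: fp_ge0.
rewrite [RHS](@nneseriesD1 _ _ y)//; last first.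
  by move=> k _; case: ifP => _; rewrite mule_ge0 ?lee01 ?hitting_ge0.
rewrite eqxx mule1 {1}/hitting nneseries_recl//; last by move=> k _; exact: fp_ge0.
congr (_ + _)%E; rewrite -(nneseries_addn 1); last by move=> i; exact: fp_ge0.
under eq_eseriesr do rewrite addn1 fpSE.
rewrite nneseries_interchange; last by move=> i j; rewrite mule_ge0.
rewrite [RHS]eseries_mkcond; apply: eq_eseriesr => z _.
have [_|zy] /= := eqVneq z y; first by apply: eseries0 => i _ _; rewrite mule0.
have Kfin : K x z \is a fin_num by exact: kernel_fin_num.
by rewrite -(fineK Kfin) nneseriesZl// => i _; exact: fp_ge0.
Qed.

(** From [x] all the mass stays in [S], where [u] is at least [u x]; a larger value at a successor
    of positive probability would push the average of [u] strictly above [u x]. *)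
Lemma superharmonic_min_step (S : set nat) (u : nat -> R) (x z : nat) :
  (forall a b, S a -> ~ S b -> K a b = 0%E) ->
  (forall a, 0 <= u a) ->
  (\sum_(a <oo) K x a * (u a)%:E <= (u x)%:E)%E ->
  S x -> (forall a, S a -> u x <= u a) -> S z -> (0 < K x z)%E -> u z = u x.
Proof.
move=> clS u0 sup Sx umin Sz Kxz; apply/eqP; rewrite eq_le umin// andbT.
rewrite leNgt; apply/negP => uxz.
suff : ((u x)%:E < \sum_(a <oo) K x a * (u a)%:E)%E by rewrite ltNge sup.
apply: (@lt_le_trans _ _ (\sum_(a <oo) K x a * (u x)%:E + K x z * (u z - u x)%:E)%E).
  under eq_eseriesr do rewrite muleC.
  rewrite nneseriesZl// K_sum1 mule1 lteDl//.
  by rewrite mule_gt0// lte_fin subr_gt0.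
rewrite [leRHS](@nneseriesD1 _ _ z)//; last by move=> k _; rewrite mule_ge0 ?lee_fin.
rewrite [X in (X + _ <= _)%E](@nneseriesD1 _ _ z)//; last by move=> k _; rewrite mule_ge0 ?lee_fin.
rewrite addeAC; apply: leeD.
  rewrite -[K x z]fineK ?kernel_fin_num// -!EFinM -EFinD lee_fin -mulrDr addrC subrK//.
apply: lee_nneseries => [a _ _|a _]; first by rewrite mule_ge0 ?lee_fin.
have [Sa|Sa] := pselect (S a); first by rewrite lee_wpmul2l// lee_fin umin.
by rewrite (clS x a)// !mul0e.
Qed.

(** The minimal value is passed on along the path for as long as the path avoids [F], hence up to
    its first point in [F]. *)
Lemma superharmonic_min_path (S F : set nat) (u : nat -> R) (s : seq nat) x :
  (forall a b, S a -> ~ S b -> K a b = 0%E) ->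
  (forall a, 0 <= u a) ->
  (forall a, S a -> ~ F a -> (\sum_(z <oo) K a z * (u z)%:E <= (u a)%:E)%E) ->
  S x -> (forall a, S a -> u x <= u a) ->
  path (fun a b => (0 < K a b)%E) x s -> F (last x s) ->
  exists z, [/\ S z, F z & u z = u x].
Proof.
move=> clS u0 sup; elim: s x => [|b s IH] x Sx umin /=.
  by move=> _ Fx; exists x.
move=> /andP[Kxb sP] Fl.
have [Fx|nFx] := pselect (F x); first by exists x.
have Sb : S b.
  by apply: contrapT => nSb; move: Kxb; rewrite clS// ltxx.
have ubx : u b = u x by refine (superharmonic_min_step clS u0 (sup _ Sx nFx) Sx umin Sb Kxb).
have [|z [Sz Fz uz]] := IH b Sb _ sP Fl; first by move=> a Sa; rewrite ubx umin.
by exists z; rewrite uz.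
Qed.

Lemma exists_min_below (S : set nat) (u : nat -> R) (N x0 : nat) :
  S x0 -> (x0 <= N)%N ->
  exists z, [/\ S z, (z <= N)%N & forall a, S a -> (a <= N)%N -> u z <= u a].
Proof.
move=> Sx0 x0N; pose i0 : 'I_N.+1 := Ordinal (x0N : (x0 < N.+1)%N).
have Pi0 : `[< S i0 >] by apply/asboolP.
case: (@arg_minP _ _ _ i0 (fun i : 'I_N.+1 => `[< S i >]) (fun i => u i) Pi0).
move=> z /asboolP Sz zmin; exists z; split => //; first by rewrite -ltnS.
by move=> a Sa aN; apply: (zmin (Ordinal (aN : (a < N.+1)%N))); exact/asboolP.
Qed.

(** The hitting probability of [y] need not attain its infimum over [S], but its sum with a small
    multiple of [V] does. The minimum principle moves that minimum below [N']; letting the multiple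
    shrink, the hitting probability attains its minimum as well. A second use of the principle moves
    this minimum to [y], where the value is 1. *)
Theorem foster_recurrence (S : set nat) (V : nat -> R) (N : nat) :
  irreducible_on K S ->
  (forall x, 0 <= V x) ->
  (forall A, exists n, forall x, (n <= x)%N -> A < V x) ->
  (forall x, S x -> (N <= x)%N -> (\sum_(z <oo) K x z * (V z)%:E <= (V x)%:E)%E) ->
  forall y, S y -> recurrent_state K y.
Proof.
move=> [clS irr] V0 Vinf Vsup y Sy.
(* Setting the value to 1 at [y] turns the first-step equation into superharmonicity off [y]. *)
pose h z : R := if z == y then 1 else fine (hitting y z).
have hE z : (h z)%:E = (if z == y then 1 else hitting y z)%E.
  rewrite /h; case: ifP => // _; rewrite fineK// ge0_fin_numE ?hitting_ge0//.
  by apply: (le_lt_trans (hitting_le1 y z)); rewrite ltry.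
have h0 z : 0 <= h z by rewrite -lee_fin hE; case: ifP; rewrite ?lee01 ?hitting_ge0.
have sumh x : hitting y x = (\sum_(z <oo) K x z * (h z)%:E)%E.
  by rewrite hittingE; apply: eq_eseriesr => z _; rewrite hE.
have hsup x : x != y -> (\sum_(z <oo) K x z * (h z)%:E <= (h x)%:E)%E.
  by move=> /negbTE xy; rewrite -sumh hE xy.
(* Including [y] below the threshold guarantees that every path ending at [y] meets the finite
   set. *)
pose N' := maxn N y.
have [x1 [Sx1 x1N x1min]] := exists_min_below h Sy (leq_maxr N y : (y <= N')%N).
have hmin x : S x -> h x1 <= h x.
  move=> Sx; apply/ler_addgt0Pr => e e0.
  (* Chosen so that [dl * V x <= e]; the added 1 covers [V x = 0]. *)
  pose dl := e / (V x + 1).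
  have Vx1 : 0 < V x + 1 by rewrite ltr_wpDl.
  have dl0 : 0 < dl by rewrite divr_gt0.
  pose u z := h z + dl * V z.
  have u0 z : 0 <= u z by rewrite addr_ge0// mulr_ge0// ltW.
  (* Beyond [n] the term [dl * V] alone exceeds [u y], so a minimum over a finite set containing [y]
     is a minimum over [S]. *)
  have [n nV] := Vinf (u y / dl).
  have [x2 [Sx2 x2n x2min]] := exists_min_below u Sy (leq_maxr n y).
  have umin a : S a -> u x2 <= u a.
    move=> Sa; have [an|an] := leqP a (maxn n y); first exact: x2min.
    apply: (@le_trans _ _ (u y)); first by rewrite x2min// leq_maxr.
    have /nV : (n <= a)%N by rewrite (leq_trans _ (ltnW an))// leq_maxl.
    rewrite ltr_pdivrMr// => /ltW/le_trans; apply.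
    by rewrite mulrC /u lerDr.
  have usup a : S a -> ~ (a <= N')%N -> (\sum_(z <oo) K a z * (u z)%:E <= (u a)%:E)%E.
    move=> Sa /negP; rewrite -ltnNge /N' gtn_max => /andP[Na ya].
    have Ku z : (K a z * (u z)%:E = K a z * (h z)%:E + dl%:E * (K a z * (V z)%:E))%E.
      have dV0 : 0 <= dl * V z by rewrite mulr_ge0// ltW.
      by rewrite /u EFinD ge0_muleDr ?lee_fin// EFinM [X in (_ + X)%E]muleCA.
    rewrite (eq_eseriesr (fun z _ => Ku z)).
    rewrite nneseriesD; [|by move=> *; rewrite !mule_ge0 ?lee_fin// ltW..].
    rewrite nneseriesZl; last by move=> *; rewrite mule_ge0 ?lee_fin.
    rewrite [in leRHS]/u EFinD leeD ?hsup ?gtn_eqF//.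
    by rewrite [leRHS]EFinM lee_pmul2l ?lte_fin// Vsup// ltnW.
  have [s [sP sl]] := irr x2 y Sx2 Sy.
  have [|z [Sz zN uz]] :=
    superharmonic_min_path (F := [set a | (a <= N')%N]) clS u0 usup Sx2 umin sP.
    by rewrite sl /= leq_maxr.
  (* The chain is [h x1 <= h z <= u z = u x2 <= u x <= h x + e]. *)
  apply: (@le_trans _ _ (u x)).
    apply: (@le_trans _ _ (u x2)); last exact: umin.
    by rewrite -uz (le_trans (x1min z Sz zN))// /u lerDl mulr_ge0// ltW.
  have q1 : (V x + 1)^-1 * V x <= 1.
    by rewrite mulrC ler_pdivrMr// mul1r lerDl.
  by rewrite /u lerD2l /dl -mulrA ler_piMr// ltW.
have [s [sP sl]] := irr x1 y Sx1 Sy.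
have [||z [Sz -> hz]] :=
    superharmonic_min_path (F := [set y]) clS h0 _ Sx1 hmin sP.
- by move=> a Sa /eqP ay; exact: hsup.
- by rewrite sl.
have h1 x : S x -> (1 <= (h x)%:E)%E.
  by move=> Sx; rewrite lee_fin (le_trans _ (hmin x Sx))// -hz /h eqxx.
apply/eqP; rewrite eq_le; apply/andP; split; first exact: hitting_le1.
(* With [h >= 1] on [S], the first-step equation at [y] bounds the return probability below by the
   total mass of [K y]. *)
rewrite -[leRHS]/(hitting y y) sumh -(K_sum1 y).
apply: lee_nneseries => [*|x _]; first exact: K_ge0.
have [Sx|nSx] := pselect (S x); last by rewrite clS// mul0e.
by rewrite -{1}[K y x]mule1 lee_wpmul2l// h1.
Qed.

End Foster.

(** * Integrals weighted by functions of the environment *)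

Section IntegralComp.
Import HBNNSimple.
Context {R : realType} {d de : measure_display} {T : measurableType d}
  {E : measurableType de} (mu : {measure set T -> \bar R}) (phi : T -> E).
Hypothesis mphi : measurable_fun setT phi.

Lemma integral_comp_nnsfun (c : T -> R) (g : {nnsfun E >-> R}) :
  measurable_fun setT c -> (forall t, 0 <= c t) ->
  (\int[mu]_t ((g (phi t))%:E * (c t)%:E) =
   \sum_(r \in range g) (r%:E * \int[mu]_(t in phi @^-1` (g @^-1` [set r])) (c t)%:E))%E.
Proof.
move=> mc c0.
have mpre r : measurable (phi @^-1` (g @^-1` [set r])).
  by rewrite -[X in measurable X]setTI; exact: mphi.
under eq_integral => t _.
  rewrite fimfunE -fsumEFin// ge0_mule_fsuml; last first.
    by move=> r; rewrite EFinM nnfun_muleindic_ge0.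
  over.
rewrite ge0_integral_fsum//; last 2 first.
- move=> r; apply: emeasurable_funM; last exact/measurable_EFinP.
  apply/measurable_EFinP.
  apply: measurable_funM; first exact: measurable_cst.
  by apply: (measurableT_comp _ mphi); exact: measurable_indic.
- by move=> r t _; rewrite mule_ge0 ?lee_fin// -lee_fin EFinM nnfun_muleindic_ge0.
apply: eq_fsbigr => r; rewrite inE => -[e _ <-].
rewrite [in RHS]integral_mkcond -ge0_integralZl//.
- apply: eq_integral => t _; rewrite /= patchE indicE.
  have -> : (phi t \in g @^-1` [set g e]) = (t \in phi @^-1` (g @^-1` [set g e])).
    by apply/idP/idP; rewrite !inE.
  by case: (_ \in _); rewrite ?mulr1 ?mulr0 ?mul0e ?mule0.
- apply/(measurable_restrictT _ (mpre _)).1; apply: measurable_funTS; exact/measurable_EFinP.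
- by move=> t _; apply: erestrict_ge0 => s _; rewrite lee_fin.
- by rewrite lee_fin.
Qed.

(** The assumption says that [a] and [b] have the same conditional expectation given [phi]. Equality
    passes from indicators to simple functions, and to all nonnegative [G] by monotone
    convergence. *)
Lemma eq_integral_comp (a b : T -> R) (G : E -> \bar R) :
  measurable_fun setT a -> measurable_fun setT b ->
  (forall t, 0 <= a t) -> (forall t, 0 <= b t) ->
  (forall B, measurable B ->
    (\int[mu]_(t in phi @^-1` B) (a t)%:E = \int[mu]_(t in phi @^-1` B) (b t)%:E)%E) ->
  measurable_fun setT G -> (forall e, 0 <= G e)%E ->
  (\int[mu]_t (G (phi t) * (a t)%:E) = \int[mu]_t (G (phi t) * (b t)%:E))%E.
Proof.
move=> ma mb a0 b0 ab mG G0.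
pose Gn := nnsfun_approx measurableT mG.
have key (c : T -> R) : measurable_fun setT c -> (forall t, 0 <= c t) ->
  (\int[mu]_t (G (phi t) * (c t)%:E) =
   limn (fun n => \int[mu]_t ((Gn n (phi t))%:E * (c t)%:E)))%E.
  move=> mc c0; rewrite -monotone_convergence//.
  - apply: eq_integral => t _; apply/esym/cvg_lim => //.
    rewrite muleC; under eq_fun do rewrite muleC.
    by apply: cvgeZl => //; exact: cvg_nnsfun_approx.
  - move=> n; apply: emeasurable_funM; last exact/measurable_EFinP.
    by apply/measurable_EFinP; exact: measurableT_comp.
  - by move=> n t _; rewrite mule_ge0 ?lee_fin.
  - move=> t _ m n mn; rewrite lee_wpmul2r ?lee_fin//.
    by have /lefP := nd_nnsfun_approx measurableT mG mn; exact.
rewrite !key//; congr (limn _); apply/funext => n.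
rewrite !integral_comp_nnsfun//; apply: eq_fsbigr => r _.
by rewrite ab//.
Qed.

End IntegralComp.

(** * Inequalities and limits for the iterated logarithm *)

Section LogLog.
Context {R : realType}.
Implicit Types a b t u x : R.

(** The shift by [expR 1] gives [loge >= 1] and [loglog >= 0] on all nonnegative reals, so small
    states need no separate treatment. *)
Definition loge (t : R) : R := ln (expR 1 + t).

Definition loglog (t : R) : R := ln (loge t).

Lemma loge_arg_gt0 t : 0 <= t -> 0 < expR 1 + t.
Proof. by move=> t0; rewrite ltr_pwDl// expR_gt0. Qed.

Lemma loge_ge1 t : 0 <= t -> 1 <= loge t.
Proof.
move=> t0; rewrite /loge -[leLHS](expRK 1) ler_ln ?posrE ?expR_gt0 ?loge_arg_gt0//.
by rewrite lerDl.
Qed.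

Lemma loge_gt0 t : 0 <= t -> 0 < loge t.
Proof. by move=> /loge_ge1; apply: lt_le_trans. Qed.

Lemma loglog_ge0 t : 0 <= t -> 0 <= loglog t.
Proof. by move=> /loge_ge1; exact: ln_ge0. Qed.

Lemma ln_le_sub1 x : 0 < x -> ln x <= x - 1.
Proof.
by move=> x0; rewrite -{1}(subrK 1 x) addrC le_ln1Dx// ltrBrDr addNr.
Qed.

(** Concavity in tangent form, the factor of [b - a] being the derivative at [a]. It comes from
    [ln x <= x - 1], applied to the quotient of the two [loge] and then to that of their
    arguments. *)
Lemma loglog_tangent a b : 0 <= a -> 0 <= b ->
  loglog b <= loglog a + (b - a) / ((expR 1 + a) * loge a).
Proof.
move=> a0 b0; rewrite -lerBlDl /loglog.
have [la lb] := (loge_gt0 a0, loge_gt0 b0).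
have [ea eb] := (loge_arg_gt0 a0, loge_arg_gt0 b0).
rewrite -ln_div ?posrE// (le_trans (ln_le_sub1 _)) ?divr_gt0//.
have -> : loge b / loge a - 1 = (loge b - loge a) / loge a.
  by rewrite mulrBl divff// gt_eqF.
rewrite invfM mulrA ler_pM2r ?invr_gt0// /loge -ln_div ?posrE//.
rewrite (le_trans (ln_le_sub1 _)) ?divr_gt0//.
rewrite le_eqVlt; apply/orP; left; apply/eqP; field.
by rewrite gt_eqF.
Qed.

(** A bounded stand-in for the quadratic term of the logarithm: of order [t ^+ 2] near 0, zero only
    at 0, and bounded, so that it is always integrable. *)
Definition quad (t : R) : R := t ^+ 2 / (1 + t ^+ 2) / 5.

Lemma quad_den_gt0 t : 0 < 1 + t ^+ 2.
Proof. by rewrite ltr_pwDl// sqr_ge0. Qed.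

Lemma quad_ge0 t : 0 <= quad t.
Proof. by rewrite divr_ge0// divr_ge0 ?sqr_ge0// ltW ?quad_den_gt0. Qed.

Lemma quad_le1 t : quad t <= 1.
Proof.
rewrite /quad ler_pdivrMr// mul1r ler_pdivrMr ?quad_den_gt0//.
by have := sqr_ge0 t; lra.
Qed.

Lemma quad_eq0 t : quad t = 0 -> t = 0.
Proof.
move=> /eqP; rewrite /quad mulf_eq0 invr_eq0 pnatr_eq0 orbF.
by rewrite mulf_eq0 invr_eq0 (gt_eqF (quad_den_gt0 t)) orbF sqrf_eq0 => /eqP.
Qed.

(* With [s = sqrt (1 + u)], [ln (1 + u) = 2 ln s <= 2 (s - 1) = u - (s - 1)^2]. *)
Lemma ln1D_le_quad u : -1 < u -> ln (1 + u) <= u - quad u.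
Proof.
move=> u1; have u1' : 0 < 1 + u by lra.
pose s := Num.sqrt (1 + u).
have s0 : 0 < s by rewrite sqrtr_gt0.
have ss : s ^+ 2 = 1 + u by rewrite sqr_sqrtr// ltW.
rewrite -ss lnXn// mulr2n.
have := ln_le_sub1 s0.
suff : quad u <= (s - 1) ^+ 2 by move: ss; nra.
have -> : u = s ^+ 2 - 1 by lra.
rewrite /quad ler_pdivrMr// ler_pdivrMr ?quad_den_gt0//.
have -> : (s ^+ 2 - 1) ^+ 2 = (s - 1) ^+ 2 * (s + 1) ^+ 2 by ring.
rewrite -mulrA ler_wpM2l ?sqr_ge0//.
rewrite -subr_ge0.
(* A sum-of-squares certificate that the constant 5 in [quad] is large enough. *)
have -> : 5 * (1 + (s - 1) ^+ 2 * (s + 1) ^+ 2) - (s + 1) ^+ 2 =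
   5 * (s ^+ 2 - 6 / 5) ^+ 2 + (s - 1) ^+ 2 + 4 / 5 by field.
by have := sqr_ge0 (s ^+ 2 - 6 / 5); have := sqr_ge0 (s - 1); lra.
Qed.

(** Used with [x = L] to extract the factor [L ^- 2]; it reduces to
    [x ^+ 2 + t ^+ 2 <= x ^+ 2 * (1 + t ^+ 2)]. *)
Lemma quad_div t x : 1 <= x -> quad t / x ^+ 2 <= quad (t / x).
Proof.
move=> x1; have x0 : 0 < x by lra.
have xx : 1 <= x ^+ 2 by rewrite exprn_ege1.
rewrite /quad mulrAC ler_pM2r ?invr_gt0//.
have -> : (t / x) ^+ 2 / (1 + (t / x) ^+ 2) = t ^+ 2 / (x ^+ 2 + t ^+ 2).
  have h1 : x ^+ 2 + t ^+ 2 != 0 by rewrite gt_eqF// ltr_pwDl ?exprn_gt0// sqr_ge0.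
  by field; rewrite h1 gt_eqF.
rewrite -mulrA -invfM ler_wpM2l ?sqr_ge0// lef_pV2 ?posrE.
- by have := sqr_ge0 t; nra.
- by rewrite mulr_gt0 ?quad_den_gt0// exprn_gt0.
- by rewrite ltr_pwDl ?sqr_ge0// exprn_gt0.
Qed.

(* The error in [loge (m x + M) <= loge x + ln m + excess m M x]. *)
Definition excess (m M x : R) : R := ln (1 + expR (loge M - ln m - loge x)).

Section Excess.
Context {m M x : R}.
Hypotheses (m0 : 0 < m) (M0 : 0 <= M) (x0 : 0 <= x).

Let ex := loge_arg_gt0 x0.
Let eM := loge_arg_gt0 M0.
Let c0 : 0 < (expR 1 + M) / (m * (expR 1 + x)).
Proof. by rewrite divr_gt0// mulr_gt0. Qed.

(** This quotient form serves the comparison with [loge (m * x + M)] and the decay in [x]; the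
    exponential form of the definition serves measurability and the bound uniform in [x]. *)
Lemma excessE : excess m M x = ln (1 + (expR 1 + M) / (m * (expR 1 + x))).
Proof.
rewrite /excess /loge !expRD !expRN !lnK ?posrE//.
by rewrite invfM mulrA.
Qed.

Lemma excess_ge0 : 0 <= excess m M x.
Proof. by rewrite ln_ge0// lerDl expR_ge0. Qed.

Lemma loge_affine_le : loge (m * x + M) <= loge x + (ln m + excess m M x).
Proof.
have c1 : 0 < 1 + (expR 1 + M) / (m * (expR 1 + x)) by rewrite ltr_pwDl// ltW.
rewrite excessE /loge -lnM ?posrE// -lnM ?posrE ?mulr_gt0//.
rewrite ler_ln ?posrE ?mulr_gt0//; last by rewrite loge_arg_gt0// addr_ge0// mulr_ge0// ltW.
have -> : (expR 1 + x) * (m * (1 + (expR 1 + M) / (m * (expR 1 + x)))) =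
  m * (expR 1 + x) + (expR 1 + M) by field; rewrite !gt_eqF.
by have := mulr_gt0 m0 (expR_gt0 1); lra.
Qed.

(** Bound [loge (m * x + M)] by [L * (1 + D / L)] and apply [ln1D_le_quad] to [D / L]. The term
    [ln m / L] is isolated because its mean will vanish; the remainder carries the factor
    [L ^- 2]. *)
Lemma loglog_affine_le : loglog (m * x + M) <= loglog x + ln m / loge x +
  (loge x * excess m M x - quad (ln m + excess m M x)) / loge x ^+ 2.
Proof.
set L := loge x; set D := ln m + excess m M x.
have L1 : 1 <= L by exact: loge_ge1.
have L0 : 0 < L by lra.
have l1 : 1 <= loge (m * x + M) by rewrite loge_ge1// addr_ge0// mulr_ge0// ltW.
have lD := loge_affine_le; rewrite -/L -/D in lD.
(* Here [L + D >= loge (m * x + M) >= 1]. *)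
have u1 : 0 < 1 + D / L.
  have -> : 1 + D / L = (L + D) / L by field; rewrite gt_eqF.
  by rewrite divr_gt0//; lra.
have : loglog (m * x + M) <= ln (L * (1 + D / L)).
  rewrite /loglog ler_ln ?posrE ?mulr_gt0//; last by lra.
  by rewrite mulrDr mulr1 mulrCA divff ?mulr1// gt_eqF.
rewrite lnM ?posrE// => /le_trans; apply.
rewrite -/(loglog x) -addrA lerD2l.
have := @ln1D_le_quad (D / L); have := quad_div D L1.
have -> : ln m / L + (L * excess m M x - quad D) / L ^+ 2 = D / L - quad D / L ^+ 2.
  by rewrite /D; field; rewrite gt_eqF.
by move=> q /(_ ltac:(lra)); lra.
Qed.

Lemma expR_ge_sqr t : 0 <= t -> t ^+ 2 / 4 <= expR t.
Proof.
move=> t0; have -> : t = t / 2 + t / 2 by field.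
rewrite expRD; have := expR_ge1Dx (t / 2); nra.
Qed.

(** Decay in [x] for fixed [m] and [M]: the excess is at most [C / (expR 1 + x)], and
    [expR 1 + x = expR L >= L ^+ 2 / 4]. *)
Lemma loge_excess_le_div :
  loge x * excess m M x <= 4 * ((expR 1 + M) / m) / loge x.
Proof.
have L0 := loge_gt0 x0.
have C0 : 0 < (expR 1 + M) / m by rewrite divr_gt0.
have W : excess m M x <= (expR 1 + M) / m / (expR 1 + x).
  rewrite excessE (le_trans (le_ln1Dx _)) ?(lt_trans _ c0)// ?ltrN10//.
  by rewrite invfM mulrA.
have := expR_ge_sqr (ltW L0); rewrite {2}/loge lnK ?posrE// => h.
rewrite ler_pdivlMr//.
apply: (@le_trans _ _ (loge x * ((expR 1 + M) / m / (expR 1 + x)) * loge x)).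
  by rewrite ler_wpM2r ?(ltW L0)// ler_wpM2l// ltW.
set C := (expR 1 + M) / m in C0 *.
have -> : loge x * (C / (expR 1 + x)) * loge x = loge x ^+ 2 * C / (expR 1 + x) by ring.
by rewrite ler_pdivrMr//; nra.
Qed.

(** A bound uniform in [x], which supplies the dominating function. If [A <= L / 2] the excess is at
    most [expR (- (L / 2))], which absorbs [L]; otherwise [L < 2 * A] and the excess is at most
    [1 + A]. *)
Lemma loge_excess_le_sqr :
  loge x * excess m M x <= 2 + 6 * (loge M ^+ 2 + ln m ^+ 2).
Proof.
set L := loge x; set A := loge M - ln m.
have L0 : 0 < L := loge_gt0 x0.
have A2 : A ^+ 2 <= 2 * (loge M ^+ 2 + ln m ^+ 2).
  by rewrite /A; have := sqr_ge0 (loge M + ln m); nra.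
rewrite /excess -/A -/L.
have [AL|AL] := leP A (L / 2).
  have W : ln (1 + expR (A - L)) <= expR (- (L / 2)).
    rewrite (le_trans (le_ln1Dx _))//; first by rewrite (lt_trans _ (expR_gt0 _)).
    by rewrite ler_expR; lra.
  have h : L <= expR (L / 2).
    have -> : L / 2 = L / 4 + L / 4 by field.
    by rewrite expRD; have := expR_ge1Dx (L / 4); have := sqr_ge0 (1 - L / 4); nra.
  have : L * ln (1 + expR (A - L)) <= 1.
    rewrite (le_trans (ler_wpM2l (ltW L0) W))// expRN ler_pdivrMr ?expR_gt0//.
    by rewrite mul1r.
  have := sqr_ge0 A; lra.
have W : ln (1 + expR (A - L)) <= 1 + A.
  rewrite -[leRHS]expRK ler_ln ?posrE ?expR_gt0 ?addr_gt0 ?expR_gt0//.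
  have e2 : 2 <= expR (1 : R) by have := expR_ge1Dx (1 : R); lra.
  have eA : expR (A - L) <= expR A by rewrite ler_expR; lra.
  have A1 : 1 <= expR A by rewrite -expR0 ler_expR; lra.
  apply: (@le_trans _ _ (2 * expR A)); first by lra.
  by rewrite [leRHS]expRD ler_wpM2r ?expR_ge0.
have := ler_wpM2l (ltW L0) W; have := sqr_ge0 (A - 1); nra.
Qed.

End Excess.
Lemma loge_unbounded (A : R) : exists n, forall x : nat, (n <= x)%N -> A < loge x%:R.
Proof.
exists (Num.truncn (expR A)).+1 => x nx.
rewrite /loge -[ltLHS]expRK ltr_ln ?posrE ?expR_gt0 ?loge_arg_gt0//.
rewrite (lt_le_trans (truncnS_gt _))//.
by rewrite (@le_trans _ _ x%:R) ?ler_nat// lerDr expR_ge0.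
Qed.

Lemma loglog_unbounded (A : R) : exists n, forall x : nat, (n <= x)%N -> A < loglog x%:R.
Proof.
have [n nP] := loge_unbounded (expR A); exists n => x /nP xA.
by rewrite /loglog -[ltLHS]expRK ltr_ln ?posrE ?expR_gt0 ?loge_gt0.
Qed.

Lemma cvg_loge_nat : loge n%:R @[n --> \oo] --> +oo.
Proof.
apply/cvgryPgt => A; have [n nP] := loge_unbounded A.
by exists n => // x /= /nP.
Qed.

Section ExcessLimit.
Context {m M : R}.
Hypotheses (m0 : 0 < m) (M0 : 0 <= M).

Lemma cvg_loge_excess : loge n%:R * excess m M n%:R @[n --> \oo] --> 0.
Proof.
apply: (@squeeze_cvgr _ _ _ _ (cst 0) (fun n => 4 * ((expR 1 + M) / m) / loge n%:R)).
- apply: nearW => n; rewrite loge_excess_le_div// andbT.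
  by rewrite mulr_ge0 ?excess_ge0// ltW// loge_gt0.
- exact: cvg_cst.
- rewrite -[X in _ --> X](mulr0 (4 * ((expR 1 + M) / m))).
  apply: cvgMr; apply/gtr0_cvgV0; last exact: cvg_loge_nat.
  by apply: nearW => n; rewrite loge_gt0.
Qed.

Lemma cvg_excess : excess m M n%:R @[n --> \oo] --> 0.
Proof.
apply: (@squeeze_cvgr _ _ _ _ (cst 0) _ _ _ _ _ cvg_loge_excess).
- apply: nearW => n; rewrite excess_ge0//=.
  by rewrite ler_peMl ?excess_ge0// loge_ge1.
- exact: cvg_cst.
Qed.

Lemma continuous_quad : continuous (quad : R -> R).
Proof.
move=> t; apply: cvgMl; apply: cvgM; first exact: exprn_continuous.
apply: cvgV; first by rewrite gt_eqF// quad_den_gt0.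
by apply: cvgD; [exact: cvg_cst|exact: exprn_continuous].
Qed.

Lemma cvg_drift :
  loge n%:R * excess m M n%:R - quad (ln m + excess m M n%:R) @[n --> \oo]
    --> - quad (ln m).
Proof.
rewrite -[X in _ --> X]add0r; apply: cvgB; first exact: cvg_loge_excess.
apply: (@continuous_cvg _ _ _ _ _ _ quad); first exact: continuous_quad.
rewrite -[X in _ --> X]addr0; apply: cvgD; first exact: cvg_cst.
exact: cvg_excess.
Qed.

End ExcessLimit.

End LogLog.

(** * Measurability of the logarithmic expressions *)

Section MeasurableLog.
Context {R : realType} {d : measure_display} {T : measurableType d}.
Implicit Types f g : T -> R.

Lemma measurable_loge f :
  measurable_fun setT f -> measurable_fun setT (fun t => loge (f t)).
Proof.
move=> mf; apply: (measurableT_comp (@measurable_ln R)).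
by apply: measurable_funD => //; exact: measurable_cst.
Qed.

Lemma measurable_loglog f :
  measurable_fun setT f -> measurable_fun setT (fun t => loglog (f t)).
Proof.
by move=> mf; apply: (measurableT_comp (@measurable_ln R)); exact: measurable_loge.
Qed.

Lemma measurable_quad f :
  measurable_fun setT f -> measurable_fun setT (fun t => quad (f t)).
Proof.
move=> mf; apply: measurableT_comp => //.
by apply: continuous_measurable_fun; exact: continuous_quad.
Qed.

Lemma measurable_excess f g x : measurable_fun setT f -> measurable_fun setT g ->
  measurable_fun setT (fun t => excess (f t) (g t) x).
Proof.
move=> mf mg; apply: (measurableT_comp (@measurable_ln R)).
apply: measurable_funD; first exact: measurable_cst.
apply: (measurableT_comp (@measurable_expR R)).
apply: measurable_funB; last exact: measurable_cst.
apply: measurable_funB; first exact: measurable_loge.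
exact: (measurableT_comp (@measurable_ln R)).
Qed.

End MeasurableLog.

(** * Negative drift of the iterated logarithm along the quenched means *)

Section Drift.
Context {R : realType} {d : measure_display} {T : measurableType d}
  (Q : probability T R).

Lemma integral_probability_cst (c : R) : (\int[Q]_t c%:E = c%:E)%E.
Proof.
rewrite (integral_cst Q measurableT) -[RHS]mule1; congr (_ * _)%E.
exact: probability_setT.
Qed.

Lemma integrable_ge0_real (f : T -> R) : measurable_fun setT f ->
  (forall t, 0 <= f t) -> (\int[Q]_t (f t)%:E < +oo)%E ->
  Q.-integrable setT (fun t => (f t)%:E).
Proof.
move=> mf f0 foo; apply/integrableP; split; first exact/measurable_EFinP.
by under eq_integral => t _ do rewrite gee0_abs ?lee_fin//.
Qed.

Lemma integrable_of_sqr (f : T -> R) : measurable_fun setT f ->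
  (\int[Q]_t (f t ^+ 2)%:E < +oo)%E -> Q.-integrable setT (fun t => (f t)%:E).
Proof.
move=> mf foo.
have i2 : Q.-integrable setT (fun t => (f t ^+ 2)%:E).
  by apply: integrable_ge0_real => // [|t]; [exact: measurable_funX|exact: sqr_ge0].
have i1 : Q.-integrable setT (fun t => 1%:E + (f t ^+ 2)%:E)%E.
  by apply: integrableD => //; exact: finite_measure_integrable_cst.
apply: le_integrable i1 => //; first exact/measurable_EFinP.
move=> t _; rewrite -EFinD !abse_EFin lee_fin.
rewrite [leRHS]ger0_norm; last by rewrite addr_ge0// sqr_ge0.
by rewrite -[f t ^+ 2]real_normK ?num_real//; have := sqr_ge0 (`|f t| - 1); nra.
Qed.

Variables m M : T -> R.
Hypotheses (mm : measurable_fun setT m) (mM : measurable_fun setT M).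
Hypotheses (m_gt0 : forall t, 0 < m t) (M_ge0 : forall t, 0 <= M t).
Hypothesis m_sqr : (\int[Q]_t (ln (m t) ^+ 2)%:E < +oo)%E.
Hypothesis M_sqr : (\int[Q]_t (loge (M t) ^+ 2)%:E < +oo)%E.
Hypothesis m_centered : (\int[Q]_t (ln (m t))%:E = 0)%E.
Hypothesis m_nondeg : (0 < \int[Q]_t (quad (ln (m t)))%:E)%E.

(** The numerator of the [L ^- 2] term in [loglog_affine_le]. *)
Let drift (n : nat) (t : T) : R :=
  loge n%:R * excess (m t) (M t) n%:R - quad (ln (m t) + excess (m t) (M t) n%:R).

(** The constant 3 is the 2 of [loge_excess_le_sqr] plus 1 for [quad]. *)
Let bound (t : T) : R := 3 + 6 * (loge (M t) ^+ 2 + ln (m t) ^+ 2).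

Let mlnm : measurable_fun setT (fun t => ln (m t)).
Proof. exact: (measurableT_comp (@measurable_ln R)). Qed.

Let mdrift n : measurable_fun setT (drift n).
Proof.
have me : measurable_fun setT (fun t => excess (m t) (M t) n%:R).
  exact: measurable_excess.
apply: measurable_funB; first by apply: measurable_funM => //; exact: measurable_cst.
by apply: measurable_quad; exact: measurable_funD.
Qed.

Let integrable_bound : Q.-integrable setT (fun t => (bound t)%:E).
Proof.
have i1 : Q.-integrable setT (fun t => (ln (m t) ^+ 2)%:E).
  by apply: integrable_ge0_real => // [|t]; [exact: measurable_funX|exact: sqr_ge0].
have i2 : Q.-integrable setT (fun t => (loge (M t) ^+ 2)%:E).
  apply: integrable_ge0_real => // [|t]; last exact: sqr_ge0.
  by apply: measurable_funX; exact: measurable_loge.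
have i3 : Q.-integrable setT (fun t => 6%:E * ((loge (M t) ^+ 2)%:E + (ln (m t) ^+ 2)%:E))%E.
  by apply: integrableZl => //; exact: integrableD.
have i4 : Q.-integrable setT (EFin \o cst 3) by exact: finite_measure_integrable_cst.
by have := integrableD measurableT i4 i3.
Qed.

Let drift_bound n t : (`|(drift n t)%:E| <= (bound t)%:E)%E.
Proof.
rewrite abse_EFin lee_fin /drift /bound.
have n0 : 0 <= n%:R :> R by [].
have h1 := @loge_excess_le_sqr R (m t) (M t) _ n0.
have h2 : 0 <= loge n%:R * excess (m t) (M t) n%:R.
  by rewrite mulr_ge0 ?excess_ge0// ltW// loge_gt0.
have := quad_ge0 (ln (m t) + excess (m t) (M t) n%:R).
have := quad_le1 (ln (m t) + excess (m t) (M t) n%:R).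
have := sqr_ge0 (loge (M t)); have := sqr_ge0 (ln (m t)).
by rewrite ler_norml => *; apply/andP; split; lra.
Qed.

Let integrable_drift n : Q.-integrable setT (fun t => (drift n t)%:E).
Proof.
apply: le_integrable integrable_bound => //; first exact/measurable_EFinP.
move=> t _; rewrite (le_trans (drift_bound n t))// abse_EFin lee_fin.
exact: ler_norm.
Qed.

(** By dominated convergence the mean of [drift n] tends to minus the mean of [quad (ln m)], which
    is strictly negative, so it is negative for all large [n]. Integrating [loglog_affine_le] then
    leaves only this term, as [ln m] is centred. *)
Lemma loglog_drift_le : exists N : nat, forall n : nat, (N <= n)%N ->
  (\int[Q]_t (loglog (m t * n%:R + M t))%:E <= (loglog n%:R)%:E)%E.
Proof.
have [] := @dominated_convergence _ _ _ Q setT measurableT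
  (fun n t => (drift n t)%:E) (fun t => (- quad (ln (m t)))%:E)
  (fun t => (bound t)%:E).
- by move=> n; exact/measurable_EFinP.
- apply/measurable_EFinP; apply: measurableT_comp => //; exact: measurable_quad.
- apply: aeW => t _; apply: cvg_EFin; first exact: nearW.
  exact: cvg_drift.
- exact: integrable_bound.
- by apply: aeW => t n _; exact: drift_bound.
move=> iq _ cvg.
have qlt0 : (\int[Q]_t (- quad (ln (m t)))%:E < 0)%E.
  under eq_integral do rewrite EFinN.
  by rewrite integral_ge0N ?oppe_lt0// => t _; rewrite lee_fin quad_ge0.
have qfin := integrable_fin_num measurableT iq.
move: cvg => /=; rewrite -(fineK qfin) => /fine_cvgP[_ cvg].
have q0 : fine (\int[Q]_t (- quad (ln (m t)))%:E) < 0 by rewrite -lte_fin fineK.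
have [N _ NP] := cvgr_lt _ cvg _ q0.
exists N => n /NP /= dn.
have dint : (\int[Q]_t (drift n t)%:E <= 0)%E.
  by rewrite -(fineK (integrable_fin_num measurableT (integrable_drift n))) lee_fin ltW.
set L : R := loge n%:R.
have iY := integrable_of_sqr mlnm m_sqr.
have i1 : Q.-integrable setT (EFin \o cst (loglog (n%:R : R))).
  exact: finite_measure_integrable_cst.
have i2 := integrableZl measurableT (L^-1) iY.
have i3 := integrableZl measurableT (L ^- 2) (integrable_drift n).
have n0 : 0 <= n%:R :> R by [].
have arg0 t : 0 <= m t * n%:R + M t by rewrite addr_ge0// mulr_ge0// ltW.
have le t : ((loglog (m t * n%:R + M t))%:E <=
  (loglog n%:R)%:E + (L^-1%:E * (ln (m t))%:E + (L ^- 2)%:E * (drift n t)%:E))%E.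
  rewrite -!EFinM -!EFinD lee_fin addrA [L^-1 * _]mulrC [L ^- 2 * _]mulrC.
  exact: loglog_affine_le.
apply: (@le_trans _ _ (\int[Q]_t ((loglog n%:R)%:E +
   (L^-1%:E * (ln (m t))%:E + (L ^- 2)%:E * (drift n t)%:E)))%E).
  apply: ge0_le_integral => //.
  - by move=> t _; rewrite lee_fin loglog_ge0.
  - apply/measurable_EFinP; apply: measurable_loglog; apply: measurable_funD => //.
    by apply: measurable_funM => //; exact: measurable_cst.
  - have := integrableD measurableT i1 (integrableD measurableT i2 i3).
    by move=> /integrableP[].
rewrite integralD//; last exact: integrableD.
rewrite integralD// !integralZl// m_centered mule0 add0e.
rewrite integral_probability_cst.
rewrite -[leRHS]adde0 leeD2l// mule_ge0_le0// lee_fin.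
by rewrite invr_ge0 exprn_ge0// ltW// loge_gt0.
Qed.

End Drift.

(** * Random variables with values in the natural numbers *)

Section NatValued.
Context {R : realType} {d : measure_display} {T : measurableType d}
  (Q : probability T R).
Implicit Types h : T -> nat.

Lemma measurable_fun_of_nat h (F : nat -> R) :
  (forall k, measurable (h @^-1` [set k])) ->
  measurable_fun setT (fun t => F (h t)).
Proof.
move=> mh _ B _; rewrite setTI.
have -> : (fun t => F (h t)) @^-1` B = \bigcup_(k in F @^-1` B) (h @^-1` [set k]).
  apply/seteqP; split=> [t Bt|t [k Bk /= hk]]; first by exists (h t).
  by rewrite /preimage /= hk.
by apply: bigcup_measurable => k _; exact: mh.
Qed.

Lemma measurable_preimage_nat h :
  measurable_fun setT (fun t => (h t)%:R : R) ->
  forall k, measurable (h @^-1` [set k]).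
Proof.
move=> mh k.
have -> : h @^-1` [set k] = setT `&` (fun t => (h t)%:R : R) @^-1` [set k%:R].
  apply/seteqP; split=> [t /= ->//|t /= [_ /eqP]].
  by rewrite eqr_nat => /eqP.
exact: mh.
Qed.

Lemma sum_preimage_nat h (F : nat -> R) :
  (forall k, measurable (h @^-1` [set k])) -> (forall k, 0 <= F k) ->
  (\sum_(z <oo) Q (h @^-1` [set z]) * (F z)%:E = \int[Q]_t (F (h t))%:E)%E.
Proof.
move=> mh F0.
have hT : \bigcup_k (h @^-1` [set k]) = setT.
  by apply/seteqP; split=> // t _; exists (h t).
have tr : trivIset setT (fun k => h @^-1` [set k]).
  apply/trivIsetP => i j _ _ ij; apply/seteqP; split=> // t /= [hi hj].
  by move: ij; rewrite -hi -hj eqxx.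
have := ge0_integral_bigcup Q mh (f := fun t => (F (h t))%:E).
rewrite hT => ->//; last 2 first.
- exact/measurable_EFinP/measurable_fun_of_nat.
- by move=> t _; rewrite lee_fin.
apply: eq_eseriesr => z _.
rewrite (eq_integral (fun=> (F z)%:E)); last by move=> t; rewrite inE /= => ->.
by rewrite integral_cst// muleC.
Qed.

End NatValued.

(** * Events of probability one *)

Section Probability1.
Context {R : realType} {d : measure_display} {T : measurableType d}
  (Q : probability T R).

Lemma probability1_ae (A : set T) : measurable A -> Q A = 1%E ->
  {ae Q, forall t, A t}.
Proof.
move=> mA QA; exists (~` A); split=> //; first exact: measurableC.
by rewrite probability_setC// QA subee.
Qed.

Lemma ae_probability1 (A : set T) : measurable A ->
  {ae Q, forall t, A t} -> Q A = 1%E.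
Proof.
move=> mA [N [mN QN AN]].
have QA : Q (~` A) = 0%E.
  apply/eqP; rewrite -measure_le0 -QN le_measure ?inE//; exact: measurableC.
by rewrite -[A]setCK probability_setC ?QA ?sube0//; exact: measurableC.
Qed.

End Probability1.

(** * The branching step: conditional means, Jensen's inequality and moments *)

Section Model.
Context {R : realType} {d : measure_display} {Omega : measurableType d}
  {Q : probability Omega R} {de : measure_display} {E : measurableType de}
  {env : nat -> Omega -> E} {f : E -> nat -> R} {g : E -> nat}
  {xi : nat -> nat -> Omega -> nat}.
Hypothesis env_meas : forall n, measurable_fun setT (env n).
Hypothesis f_meas : forall k, measurable_fun setT (fun e => f e k).
Hypothesis g_meas : forall k, measurable (g @^-1` [set k]).
Hypothesis xi_meas : forall n j k, measurable (xi n j @^-1` [set k]).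
Hypothesis f_ge0 : forall e k, 0 <= f e k.
Hypothesis xi_law : forall (B : set E) j k, measurable B -> (0 < j)%N ->
  (Q (env 1 @^-1` B `&` [set w | xi 1 j w = k]) =
   \int[Q]_(w in env 1 @^-1` B) (f (env 1 w) k)%:E)%E.

Let mean_term_ge0 e k : (0 <= (k%:R * f e k)%:E)%E.
Proof. by rewrite lee_fin mulr_ge0. Qed.

Lemma measurable_mean_off : measurable_fun setT (mean_off f).
Proof.
apply: (@ge0_emeasurable_sum _ _ _ _ (fun k e => (k%:R * f e k)%:E) xpredT) => // k _.
by apply/measurable_EFinP; apply: measurable_funM => //; exact: measurable_cst.
Qed.

Lemma mean_off_ge0 e : (0 <= mean_off f e)%E.
Proof. by apply: nneseries_ge0 => k _ _; exact: mean_term_ge0. Qed.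

(* As [ln 0 = 0], this is the mean offspring number when the latter is positive
   and finite, and 1 otherwise. *)
Definition rmean (e : E) : R := expR (ln (fine (mean_off f e))).

Lemma rmean_gt0 e : 0 < rmean e. Proof. exact: expR_gt0. Qed.

Lemma rmeanE e : (0 < mean_off f e < +oo)%E -> (rmean e)%:E = mean_off f e.
Proof.
move=> /andP[m0 moo]; have mfin : mean_off f e \is a fin_num by rewrite ge0_fin_numE// ltW.
by rewrite /rmean lnK ?fineK// posrE -lte_fin fineK.
Qed.

Lemma measurable_ln_mean : measurable_fun setT (fun e => ln (fine (mean_off f e))).
Proof.
apply: (measurableT_comp (@measurable_ln R)).
by apply: (measurableT_comp (fine_measurable measurableT)); exact: measurable_mean_off.
Qed.

Lemma measurable_rmean : measurable_fun setT rmean.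
Proof. exact: (measurableT_comp (@measurable_expR R) measurable_ln_mean). Qed.

Let mxi j : measurable_fun setT (fun w => (xi 1 j w)%:R : R).
Proof. exact: (measurable_fun_of_nat (fun k => k%:R)). Qed.

Let menv_comp (G : E -> R) : measurable_fun setT G ->
  measurable_fun setT (fun w => G (env 1 w)).
Proof. by move=> mG; exact: measurableT_comp. Qed.

Lemma natrE_indic (k : nat) :
  (k%:R%:E = \sum_(i <oo) (i%:R * (k == i)%:R)%:E :> \bar R)%E.
Proof.
rewrite (@nneseriesD1 _ _ k)//.
rewrite eqxx mulr1 eseries0 ?adde0// => i _ /=.
by rewrite eq_sym => /negbTE ->; rewrite mulr0.
Qed.

(** Given the environment, an offspring count has mean [mean_off f]. The count is expanded over the
    events [xi 1 j = k], each indicator is traded for [f (env 1 w) k] under the integral, and the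
    series is summed back. *)
Lemma integral_offspring (G : E -> R) (j : nat) : (0 < j)%N ->
  measurable_fun setT G -> (forall e, 0 <= G e) ->
  (\int[Q]_w (G (env 1 w) * (xi 1 j w)%:R)%:E =
   \int[Q]_w ((G (env 1 w))%:E * mean_off f (env 1 w)))%E.
Proof.
move=> j0 mG G0.
have mX k : measurable_fun setT (fun w => \1_(xi 1 j @^-1` [set k]) w : R).
  exact: measurable_indic.
have mF k : measurable_fun setT (fun w => f (env 1 w) k) by exact: (menv_comp (f_meas k)).
have mGe := menv_comp mG.
have X0 k w : 0 <= \1_(xi 1 j @^-1` [set k]) w :> R by [].
have key k : (\int[Q]_w (k%:R%:E * ((G (env 1 w))%:E * (\1_(xi 1 j @^-1` [set k]) w)%:E)) =
    \int[Q]_w (k%:R%:E * ((G (env 1 w))%:E * (f (env 1 w) k)%:E)))%E.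
  rewrite !ge0_integralZl//.
  - congr (_ * _)%E.
    apply: (eq_integral_comp (env_meas 1) (G := fun e => (G e)%:E) (mX k) (mF k) (X0 k)) => //.
    + move=> B mB; rewrite -(xi_law k mB j0) integral_indic//.
        by rewrite setIC.
      by rewrite -[X in measurable X]setTI; exact: env_meas.
    + exact/measurable_EFinP.
  - apply: emeasurable_funM; exact/measurable_EFinP.
  - by move=> w _; rewrite mule_ge0 ?lee_fin.
  - apply: emeasurable_funM; exact/measurable_EFinP.
  - by move=> w _; rewrite mule_ge0 ?lee_fin.
transitivity (\sum_(k <oo)
   \int[Q]_w (k%:R%:E * ((G (env 1 w))%:E * (\1_(xi 1 j @^-1` [set k]) w)%:E)))%E.
  rewrite -integral_nneseries//; last 2 first.
  - move=> k; apply: emeasurable_funM; first exact: measurable_cst.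
    by apply: emeasurable_funM; exact/measurable_EFinP.
  - by move=> k w _; rewrite !mule_ge0 ?lee_fin.
  apply: eq_integral => w _.
  rewrite EFinM natrE_indic -nneseriesZl; last by move=> i _; rewrite lee_fin mulr_ge0.
  apply: eq_eseriesr => k _; rewrite EFinM muleCA; congr (_ * (_ * _%:E))%E.
  rewrite indicE; congr (_%:R); congr nat_of_bool.
  by apply/eqP/idP; rewrite inE.
rewrite (eq_eseriesr (fun k _ => key k)) -integral_nneseries//; last 2 first.
- move=> k; apply: emeasurable_funM; first exact: measurable_cst.
  by apply: emeasurable_funM; exact/measurable_EFinP.
- by move=> k w _; rewrite !mule_ge0 ?lee_fin.
apply: eq_integral => w _; rewrite /mean_off -nneseriesZl//.
by apply: eq_eseriesr => k _; rewrite EFinM muleCA.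
Qed.

Lemma measurable_step x y : measurable (step env g xi 1 x @^-1` [set y]).
Proof.
apply: (@measurable_preimage_nat R).
have -> : (fun w => (step env g xi 1 x w)%:R : R) =
  (fun w => \sum_(j < x) (xi 1 j.+1 w)%:R + (g (env 1 w))%:R).
  by apply/funext => w; rewrite /step natrD natr_sum.
apply: measurable_funD; first exact: measurable_sum.
exact: (menv_comp (measurable_fun_of_nat (fun k => k%:R) g_meas)).
Qed.

Let K := bpire_kernel Q env g xi.

Lemma bpire_kernel_ge0 x y : (0 <= K x y)%E.
Proof. exact: measure_ge0. Qed.

Lemma sum_bpire_kernel x (F : nat -> R) : (forall k, 0 <= F k) ->
  (\sum_(z <oo) K x z * (F z)%:E = \int[Q]_w (F (step env g xi 1 x w))%:E)%E.
Proof. by move=> F0; apply: sum_preimage_nat => // k; exact: measurable_step. Qed.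

Lemma bpire_kernel_sum1 x : (\sum_(z <oo) K x z = 1)%E.
Proof.
transitivity (\sum_(z <oo) K x z * 1%:E)%E.
  by apply: eq_eseriesr => z _; rewrite mule1.
by rewrite (@sum_bpire_kernel x (fun=> 1))// integral_probability_cst.
Qed.

Hypothesis mu_fin : Q [set w | (0 < mean_off f (env 1 w) < +oo)%E] = 1%E.

Lemma mean_off_ae : {ae Q, forall w, (0 < mean_off f (env 1 w) < +oo)%E}.
Proof.
apply: (@probability1_ae _ _ _ Q [set w | (0 < mean_off f (env 1 w) < +oo)%E]) => //.
have mmu : measurable_fun setT (fun w => mean_off f (env 1 w)).
  by apply: measurableT_comp => //; exact: measurable_mean_off.
rewrite (_ : [set w | _] = (setT `&` [set w | (0 < mean_off f (env 1 w))%E]) `&`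
  (setT `&` [set w | (mean_off f (env 1 w) < +oo)%E])).
  apply: measurableI; [exact: emeasurable_fun_o_infty|exact: emeasurable_fun_infty_o].
by apply/seteqP; split=> [w /andP[]|w [[_ ? [_ ?]]]]; [|apply/andP].
Qed.

Let immig e : R := (g e)%:R.

Let mimmig : measurable_fun setT immig.
Proof. exact: (measurable_fun_of_nat (fun k => k%:R)). Qed.

(* Conditional Jensen: integrate the tangent line of [loglog] at the quenched
   mean [rmean * x + immig]. *)
Lemma integral_loglog_step_le x :
  (\int[Q]_w (loglog (step env g xi 1 x w)%:R)%:E <=
   \int[Q]_w (loglog (rmean (env 1 w) * x%:R + immig (env 1 w)))%:E)%E.
Proof.
pose a e : R := rmean e * x%:R + immig e.
have a0 e : 0 <= a e by rewrite addr_ge0// mulr_ge0// ltW// rmean_gt0.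
have ma : measurable_fun setT a.
  apply: measurable_funD => //; apply: measurable_funM; first exact: measurable_rmean.
  exact: measurable_cst.
(* The derivative of [loglog] at [a e], written as an exponential to make measurability
   immediate. *)
pose slope e : R := expR (- loge (a e) - loglog (a e)).
have slopeE e : slope e = ((expR 1 + a e) * loge (a e))^-1.
  rewrite /slope expRD !expRN /loglog !lnK ?posrE ?loge_gt0//.
    by rewrite invfM.
  exact: loge_arg_gt0.
have slope0 e : 0 <= slope e by exact: expR_ge0.
have mslope : measurable_fun setT slope.
  apply: (measurableT_comp (@measurable_expR R)); apply: measurable_funB.
    by apply: measurableT_comp => //; exact: measurable_loge.
  exact: measurable_loglog.
have mse : measurable_fun setT (fun w => slope (env 1 w)) := menv_comp mslope.
have mrm : measurable_fun setT (fun w => rmean (env 1 w)) := menv_comp measurable_rmean.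
pose s w : R := \sum_(j < x) (xi 1 j.+1 w)%:R.
have ms : measurable_fun setT s by exact: measurable_sum.
have s0 w : 0 <= s w by exact: sumr_ge0.
have stepE w : (step env g xi 1 x w)%:R = s w + immig (env 1 w) :> R.
  by rewrite /step natrD natr_sum.
(* The terms are distributed so that both sides are nonnegative and integrate additively without any
   integrability of [loglog]. *)
have tangent w : loglog (step env g xi 1 x w)%:R + slope (env 1 w) * (rmean (env 1 w) * x%:R)
    <= loglog (a (env 1 w)) + slope (env 1 w) * s w.
  have := loglog_tangent (a0 (env 1 w)) (ler0n R (step env g xi 1 x w)).
  by rewrite -slopeE stepE /a; lra.
(* [rmean] agrees with the true mean only almost surely, which is enough under the integral. *)
have mean_slope : (\int[Q]_w ((slope (env 1 w))%:E * mean_off f (env 1 w)) =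
    \int[Q]_w (slope (env 1 w) * rmean (env 1 w))%:E)%E.
  apply: ge0_ae_eq_integral => //.
  - apply: emeasurable_funM; first exact/measurable_EFinP.
    by apply: measurableT_comp => //; exact: measurable_mean_off.
  - by apply/measurable_EFinP; exact: measurable_funM.
  - by move=> w _; rewrite mule_ge0 ?lee_fin// mean_off_ge0.
  - by move=> w _; rewrite lee_fin mulr_ge0// ltW// rmean_gt0.
  - by apply: filterS mean_off_ae => w mw _; rewrite EFinM rmeanE.
have int_s : (\int[Q]_w (slope (env 1 w) * s w)%:E =
    \int[Q]_w (slope (env 1 w) * (rmean (env 1 w) * x%:R))%:E)%E.
  under eq_integral => w _ do rewrite /s mulr_sumr -sumEFin.
  rewrite ge0_integral_sum//; last 2 first.
  - by move=> j; apply/measurable_EFinP; exact: measurable_funM.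
  - by move=> j w _; rewrite lee_fin mulr_ge0.
  under eq_bigr do rewrite integral_offspring// mean_slope.
  rewrite -ge0_integral_sum//; last 2 first.
  - by move=> j; apply/measurable_EFinP; exact: measurable_funM.
  - by move=> j w _; rewrite lee_fin mulr_ge0// ltW// rmean_gt0.
  apply: eq_integral => w _; rewrite sumEFin.
  by rewrite big_const_ord iter_addr_0 mulrA mulr_natr.
(* Finiteness allows this common term to be cancelled; the integrand is at most
   [a / ((expR 1 + a) * loge a) <= 1]. *)
have fin : (\int[Q]_w (slope (env 1 w) * (rmean (env 1 w) * x%:R))%:E)%E \is a fin_num.
  rewrite ge0_fin_numE; last first.
    by apply: integral_ge0 => w _; rewrite lee_fin !mulr_ge0// ltW// rmean_gt0.
  apply: (@le_lt_trans _ _ (\int[Q]_w 1)%E); last first.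
    by rewrite (integral_probability_cst Q 1) ltry.
  apply: ge0_le_integral => //.
  - by move=> w _; rewrite lee_fin !mulr_ge0// ltW// rmean_gt0.
  - apply/measurable_EFinP; apply: measurable_funM => //.
    by apply: measurable_funM => //; exact: measurable_cst.
  move=> w _; rewrite lee_fin slopeE mulrC ler_pdivrMr; last first.
    by rewrite mulr_gt0 ?loge_gt0// loge_arg_gt0.
  rewrite mul1r (@le_trans _ _ (expR 1 + a (env 1 w)))//.
    rewrite /a /immig; have := expR_ge0 (1 : R).
    by have := ler0n R (g (env 1 w)); lra.
  by rewrite ler_peMr ?loge_ge1// ltW// loge_arg_gt0.
have mse_s : measurable_fun setT (fun w => (slope (env 1 w) * s w)%:E).
  by apply/measurable_EFinP; exact: measurable_funM.
have mse_m : measurable_fun setT (fun w => (slope (env 1 w) * (rmean (env 1 w) * x%:R))%:E).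
  apply/measurable_EFinP; apply: measurable_funM => //.
  by apply: measurable_funM => //; exact: measurable_cst.
have mstep : measurable_fun setT (fun w => (loglog ((step env g xi 1 x w)%:R : R))%:E).
  apply/measurable_EFinP.
  exact: (measurable_fun_of_nat (fun k => loglog k%:R) (measurable_step x)).
have mla : measurable_fun setT (fun w => (loglog (a (env 1 w)))%:E).
  by apply/measurable_EFinP; exact: (menv_comp (measurable_loglog ma)).
rewrite -(leeD2rE _ _ fin) -[X in (_ <= _ + X)%E]int_s.
rewrite -!ge0_integralD//.
- apply: ge0_le_integral => //.
  + move=> w _; rewrite adde_ge0// lee_fin ?loglog_ge0//.
    by rewrite !mulr_ge0// ltW// rmean_gt0.
  + exact: emeasurable_funD.
  + exact: emeasurable_funD.
  + by move=> w _; rewrite -!EFinD lee_fin tangent.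
- by move=> w _; rewrite lee_fin; exact: loglog_ge0 (a0 _).
- by move=> w _; rewrite lee_fin mulr_ge0.
- by move=> w _; rewrite lee_fin loglog_ge0.
- by move=> w _; rewrite lee_fin !mulr_ge0// ltW// rmean_gt0.
Qed.

Hypothesis mu_nondeg : (Q [set w | mean_off f (env 1 w) = 1%E] < 1)%E.

(** A zero integral would force [quad], hence [ln (rmean _)], to vanish almost surely, that is, a
    mean equal to 1 almost surely. *)
Lemma quad_ln_mean_gt0 : (0 < \int[Q]_w (quad (ln (rmean (env 1 w))))%:E)%E.
Proof.
have q0 w : (0 <= (quad (ln (rmean (env 1 w))))%:E)%E by rewrite lee_fin quad_ge0.
have mq : measurable_fun setT (fun w => (quad (ln (rmean (env 1 w))))%:E).
  apply/measurable_EFinP; apply: measurable_quad.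
  apply: (measurableT_comp (@measurable_ln R)).
  exact: (menv_comp measurable_rmean).
rewrite lt_def integral_ge0// andbT; apply/eqP => int0.
suff : Q [set w | mean_off f (env 1 w) = 1%E] = 1%E.
  by move=> Q1; move: mu_nondeg; rewrite Q1 ltxx.
apply: ae_probability1.
  have mmu : measurable_fun setT (fun w => mean_off f (env 1 w)).
    by apply: measurableT_comp => //; exact: measurable_mean_off.
  by rewrite -[X in measurable X]setTI; exact: (mmu measurableT [set 1%E] (emeasurable_set1 _)).
have /(ae_eq_integral_abs Q measurableT mq) : (\int[Q]_w `|(quad (ln (rmean (env 1 w))))%:E| = 0)%E.
  by rewrite -int0; apply: eq_integral => w _; rewrite gee0_abs.
move=> qae; apply: filterS2 qae mean_off_ae => w /(_ I) /= [] /quad_eq0 ln0 mw.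
rewrite -(rmeanE mw); congr (_%:E); apply/eqP.
by rewrite -ln_eq0 ?rmean_gt0// ln0.
Qed.

Lemma integral_sqr_loge_immig (eps : R) : 0 < eps ->
  (\int[Q]_w ((logp (g (env 1 w))%:R) `^ (2 + eps))%:E < +oo)%E ->
  (\int[Q]_w (loge (immig (env 1 w)) ^+ 2)%:E < +oo)%E.
Proof.
move=> eps0 ioo.
pose G (k : nat) : R := (logp k%:R) `^ (2 + eps).
have mnat (F : nat -> R) : measurable_fun setT (fun w => (F (g (env 1 w)))%:E).
  by apply/measurable_EFinP; exact: (menv_comp (measurable_fun_of_nat F g_meas)).
have bnd (k : nat) : loge k%:R ^+ 2 <= 10 + 2 * G k.
  have G0 : 0 <= G k by exact: powR_ge0.
  have p0 : 0 <= logp (k%:R : R) by rewrite /logp le_max lexx orbT.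
  have le2 : logp k%:R ^+ 2 <= 1 + G k.
    have [p1|p1] := leP (logp (k%:R : R)) 1.
      by rewrite (@le_trans _ _ 1) ?expr_le1 ?lerDl.
    rewrite (@le_trans _ _ (G k)) ?lerDr// -powR_mulrn// /G ler_powR ?ltW//.
    by rewrite ltrDl.
  have l0 : 0 <= loge (k%:R : R) by rewrite ltW// loge_gt0.
  have : loge k%:R <= 2 + logp (k%:R : R).
    (* For [k >= 1] the claim is [expR 1 + k <= expR 2 * k], which fails at 0; there [loge 0 = 1] is
       used instead. *)
    case: k {G0 le2 l0} p0 => [|k] p0.
      by rewrite /loge addr0 expRK; lra.
    have e2 : 2 <= expR (1 : R) by have := expR_ge1Dx (1 : R); lra.
    have k1 : 1 <= k.+1%:R :> R by rewrite ler1n.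
    apply: (@le_trans _ _ (2 + ln (k.+1%:R : R))); last first.
      by rewrite lerD2l /logp le_max lexx.
    rewrite -{1}[2](expRK (2 : R)) -lnM ?posrE ?expR_gt0// /loge ler_ln ?posrE.
    - have -> : 2 = 1 + 1 :> R by ring.
      rewrite expRD -mulrA; set e := expR 1 in e2 *; set y := k.+1%:R in k1 *.
      have h1 : e <= e * y by rewrite ler_peMr//; lra.
      have h2 : 2 * y <= e * y by rewrite ler_wpM2r//; lra.
      have h3 : 2 * (e * y) <= e * (e * y) by rewrite ler_wpM2r//; lra.
      by lra.
    - exact: loge_arg_gt0.
    - by rewrite mulr_gt0 ?expR_gt0.
  have := sqr_ge0 (logp (k%:R : R) - 2); nra.
apply: (@le_lt_trans _ _ (\int[Q]_w (10%:E + 2%:E * (G (g (env 1 w)))%:E))%E).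
  apply: ge0_le_integral => //.
  - by move=> w _; rewrite lee_fin sqr_ge0.
  - exact: (mnat (fun k => loge k%:R ^+ 2)).
  - exact: (mnat (fun k => 10 + 2 * G k)).
  - by move=> w _; rewrite -EFinM -EFinD lee_fin; exact: bnd.
have iG : Q.-integrable setT (fun w => (G (g (env 1 w)))%:E).
  apply: integrable_ge0_real => //; last by move=> w; exact: powR_ge0.
  exact: (menv_comp (measurable_fun_of_nat G g_meas)).
have i10 : Q.-integrable setT (EFin \o cst (10 : R)).
  exact: finite_measure_integrable_cst.
have i2 := integrableD measurableT i10 (integrableZl measurableT 2 iG).
have := integrable_fin_num measurableT i2; rewrite fin_numElt => /andP[_].
exact.
Qed.

End Model.

(** * Recurrence of the branching process with immigration *)

Theorem theorem1p2 (R : realType) (d : measure_display) (Omega : measurableType d)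
  (Q : probability Omega R) (de : measure_display) (E : measurableType de)
  (env : nat -> Omega -> E) (f : E -> nat -> R) (g : E -> nat)
  (xi : nat -> nat -> Omega -> nat)
  (* measurability *)
  (env_meas : forall n, measurable_fun setT (env n))
  (f_meas : forall k, measurable_fun setT (fun e => f e k))
  (g_meas : forall k, measurable (g @^-1` [set k]))
  (xi_meas : forall n j k, measurable (xi n j @^-1` [set k]))
  (* f e is a probability distribution on N_0 (coefficients of phi) *)
  (f_ge0 : forall e k, 0 <= f e k)
  (f_sum1 : forall e, (\sum_(k <oo) (f e k)%:E)%E = 1%E)
  (* (1) the environment (phi_n, M_n)_{n >= 1} is i.i.d. under Q *)
  (iid : forall (m : nat) (idx : 'I_m -> nat) (B : 'I_m -> set E),
     injective idx -> (forall i, (0 < idx i)%N) -> (forall i, measurable (B i)) ->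
     Q (env_cyl env idx B) = (\prod_(i < m) fine (Q (env 1 @^-1` B i)))%:E)
  (* conditionally on the environment, the xi^(n)_j (n, j >= 1) are
     independent, xi^(n)_j having the distribution f (env n) (p.g.f. phi_n) *)
  (quenched : forall (m : nat) (idx : 'I_m -> nat) (B : 'I_m -> set E)
     (r : nat) (gen ind val : 'I_r -> nat),
     (forall i, (0 < idx i)%N) -> (forall i, measurable (B i)) ->
     injective (fun i => (gen i, ind i)) ->
     (forall i, (0 < gen i)%N /\ (0 < ind i)%N) ->
     Q (env_cyl env idx B `&`
        \bigcap_(i in [set: 'I_r]) [set w | xi (gen i) (ind i) w = val i]) =
     (\int[Q]_(w in env_cyl env idx B)
        (\prod_(i < r) f (env (gen i) w) (val i))%:E)%E)
  (* Z is an irreducible Markov chain on N or N_0 *)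
  (S : set nat) (S_def : S = setT \/ S = [set n | (0 < n)%N])
  (irr : irreducible_on (bpire_kernel Q env g xi) S)
  (* (2) conditions on mu_1 = phi_1'(1) *)
  (mu_fin : Q [set w | (0 < mean_off f (env 1%N w) < +oo)%E] = 1%E)
  (mu_L2 : (\int[Q]_w ((ln (fine (mean_off f (env 1%N w)))) ^+ 2)%:E < +oo)%E)
  (mu_centered : (\int[Q]_w (ln (fine (mean_off f (env 1%N w))))%:E = 0)%E)
  (mu_nondeg : (Q [set w | mean_off f (env 1%N w) = 1%E] < 1)%E)
  (* (3) moment condition on the immigration *)
  (imm : exists eps : R, 0 < eps /\
     (\int[Q]_w ((logp (g (env 1%N w))%:R) `^ (2 + eps))%:E < +oo)%E) :
  forall x, S x -> recurrent_state (bpire_kernel Q env g xi) x.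
Proof.
(* The quenched law specialised to one environment and one offspring variable of generation 1. *)
have xi_law (B : set E) (j k : nat) : measurable B -> (0 < j)%N ->
    (Q (env 1%N @^-1` B `&` [set w | xi 1%N j w = k]) =
     \int[Q]_(w in env 1%N @^-1` B) (f (env 1%N w) k)%:E)%E.
  move=> mB j0.
  have bigcapI1 (A : 'I_1 -> set Omega) : \bigcap_(i in [set: 'I_1]) A i = A ord0.
    by apply/seteqP; split=> [w /(_ ord0 I)//|w Aw i _]; rewrite ord1.
  have := @quenched 1 (fun=> 1%N) (fun=> B) 1 (fun=> 1%N) (fun=> j) (fun=> k).
  rewrite /env_cyl !bigcapI1 => -> //.
    by apply: eq_integral => w _; rewrite big_ord1.
  by move=> i1 i2 _; rewrite !ord1.
have [eps [eps0 imm_fin]] := imm.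
have [||||||||N NP] := @loglog_drift_le R d Omega Q
  (* Since [ln (rmean e)] equals [ln (fine (mean_off f e))] at every [e], the moment and centring
     assumptions carry over without exceptional sets. *)
  (fun w => rmean (f := f) (env 1%N w)) (fun w => (g (env 1%N w))%:R).
- by apply: measurableT_comp => //; exact: measurable_rmean.
- apply: (measurableT_comp (measurable_fun_of_nat (fun k => k%:R) g_meas)) => //.
- by move=> w; exact: rmean_gt0.
- by [].
- by under eq_integral do rewrite /rmean expRK.
- exact: (integral_sqr_loge_immig env_meas g_meas eps0 imm_fin).
- by under eq_integral do rewrite /rmean expRK.
- exact: quad_ln_mean_gt0.
apply: (foster_recurrence (V := fun n => loglog n%:R) (N := N) _ _ irr).
- by move=> x y; exact: bpire_kernel_ge0.
- by move=> x; exact: bpire_kernel_sum1.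
- by move=> x; exact: loglog_ge0.
- exact: loglog_unbounded.
(* Superharmonicity from [N] on: Jensen's inequality, followed by the drift estimate at the quenched
   mean. *)
move=> x Sx Nx; rewrite sum_bpire_kernel//; last by move=> k; exact: loglog_ge0.
by apply: le_trans (NP x Nx); exact: integral_loglog_step_le.
Qed.
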